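(* Let $R$ be a $*$-ring and $I$ an ideal of $R$ with $I^*\subseteq I$ and $I\subseteq J(R)$. Then $R$ is strongly $J$-$*$-clean if and only if (1) $R/I$ (with the induced involution $(a+I)^*=a^*+I$) is strongly $J$-$*$-clean; (2) $R$ is abelian; and (3) every idempotent lifts modulo $I$.
   Context: All rings are associative with identity. A $*$-ring is a ring $R$ with an involution $*$, i.e. a map $a\mapsto a^*$ with $(a+b)^*=a^*+b^*$, $(ab)^*=b^*a^*$, $(a^* )^*=a$. $J(R)$ denotes the Jacobson radical of $R$. A projection is an element $e$ with $e^2=e=e^*$. A $*$-ring $R$ is strongly $J$-$*$-clean if every $a\in R$ can be written $a=e+u$ with $e$ a projection, $u\in J(R)$ and $ae=ea$. A ring is abelian if all its idempotents are central. Idempotents lift modulo $I$ means: for every $x\in R$ with $x-x^2\in I$ there is an idempotent $f\in R$ with $x-f\in I$. *)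

(* Defs.v *)
From HB Require Import structures.
From mathcomp Require Import all_boot all_algebra.
From mathcomp Require Import generic_quotient.

Set Implicit Arguments.
Unset Strict Implicit.
Unset Printing Implicit Defensive.

Import GRing.Theory.
Local Open Scope ring_scope.
Local Open Scope quotient_scope.

Definition is_involution (R : pzRingType) (star : R -> R) : Prop :=
  [/\ forall a b, star (a + b) = star a + star b,
      forall a b, star (a * b) = star b * star a &
      forall a, star (star a) = a].

Definition is_left_ideal (S : pzRingType) (M : S -> Prop) : Prop :=
  [/\ M 0,
      forall x y, M x -> M y -> M (x + y),
      forall x, M x -> M (- x) &
      forall r x, M x -> M (r * x)].

Definition is_maximal_left_ideal (S : pzRingType) (M : S -> Prop) : Prop :=
  [/\ is_left_ideal M, ~ M 1 &
      forall N : S -> Prop, is_left_ideal N -> ~ N 1 ->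
        (forall x, M x -> N x) -> forall x, N x -> M x].

Definition jacobson (S : pzRingType) (x : S) : Prop :=
  forall M : S -> Prop, is_maximal_left_ideal M -> M x.

Definition is_projection (S : pzRingType) (star : S -> S) (e : S) : Prop :=
  e * e = e /\ star e = e.

Definition strongly_J_star_clean (S : pzRingType) (star : S -> S) : Prop :=
  forall a : S, exists e u : S,
    [/\ is_projection star e, jacobson u, a = e + u & a * e = e * a].

Definition abelian_ring (S : pzRingType) : Prop :=
  forall e : S, e * e = e -> forall x : S, e * x = x * e.

Record tsideal (R : pzRingType) := TSIdeal {
  idpred : {pred R};
  tsideal0 : 0 \in idpred;
  tsidealB : forall x y, x \in idpred -> y \in idpred -> x - y \in idpred;
  tsidealMl : forall r x, x \in idpred -> r * x \in idpred;
  tsidealMr : forall r x, x \in idpred -> x * r \in idpred }.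

Definition idempotents_lift (R : pzRingType) (I : tsideal R) : Prop :=
  forall x : R, x - x * x \in idpred I ->
    exists f : R, f * f = f /\ x - f \in idpred I.

Module TSQuot.
Section Zmod.
Variables (R : pzRingType) (I : tsideal R).
Local Notation P := (idpred I).

Lemma tsidealD x y : x \in P -> y \in P -> x + y \in P.
Proof.
move=> hx hy; have h0 := tsidealB (tsideal0 I) hy.
by have := tsidealB hx h0; rewrite sub0r opprK.
Qed.

Lemma tsidealN x : x \in P -> - x \in P.
Proof. by move=> hx; have := tsidealB (tsideal0 I) hx; rewrite sub0r. Qed.

Definition equiv (x y : R) := (x - y) \in P.

Lemma equiv_is_equiv : equiv_class_of equiv.
Proof.
split=> [x|x y|y x z]; rewrite /equiv.
- by rewrite subrr tsideal0.
- apply/idP/idP => h; by rewrite -opprB tsidealN.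
- move=> h1 h2; have -> : x - z = (x - y) + (y - z) by rewrite addrA addrNK.
  by apply: tsidealD.
Qed.

Canonical equiv_equiv := EquivRelPack equiv_is_equiv.
Canonical equiv_encModRel := defaultEncModRel equiv.

Definition quot := {eq_quot equiv}.

#[export] HB.instance Definition _ : EqQuotient R equiv quot := EqQuotient.on quot.
#[export] HB.instance Definition _ := Choice.on quot.

Lemma equivP x y : (x == y %[mod quot]) = (x - y \in P).
Proof. by rewrite piE. Qed.

Definition zero : quot := lift_cst quot 0.
Definition add := lift_op2 quot +%R.
Definition opp := lift_op1 quot -%R.

Canonical pi_zero_morph := PiConst zero.

Lemma pi_opp : {morph \pi : x / - x >-> opp x}.
Proof.
move=> x; unlock opp; apply/eqP; rewrite equivP.
have := reprK (\pi_quot x); move/eqP; rewrite eqmodE /= => h.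
by rewrite opprK addrC.
Qed.
Canonical pi_opp_morph := PiMorph1 pi_opp.

Lemma pi_add : {morph \pi : x y / x + y >-> add x y}.
Proof.
move=> x y /=; unlock add; apply/eqP; rewrite equivP.
have := reprK (\pi_quot x); move/eqP; rewrite eqmodE /= => hx.
have := reprK (\pi_quot y); move/eqP; rewrite eqmodE /= => hy.
move: (repr _) (repr _) hx hy => a b hx hy.
have -> : x + y - (b + a) = - ((b - x) + (a - y)).
  by rewrite [RHS]opprD !opprB addrACA opprD.
by apply/tsidealN/tsidealD.
Qed.
Canonical pi_add_morph := PiMorph2 pi_add.

Lemma addqA : associative add.
Proof. by move=> x y z; rewrite -[x]reprK -[y]reprK -[z]reprK !piE addrA. Qed.
Lemma addqC : commutative add.
Proof. by move=> x y; rewrite -[x]reprK -[y]reprK !piE addrC. Qed.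
Lemma add0q : left_id zero add.
Proof. by move=> x; rewrite -[x]reprK !piE add0r. Qed.
Lemma addNq : left_inverse zero opp add.
Proof. by move=> x; rewrite -[x]reprK !piE addNr. Qed.

#[export] HB.instance Definition _ := GRing.isZmodule.Build quot addqA addqC add0q addNq.

Definition one : quot := lift_cst quot 1.
Definition mul := lift_op2 quot *%R.
Canonical pi_one_morph := PiConst one.

Lemma pi_mul : {morph \pi : x y / x * y >-> mul x y}.
Proof.
move=> x y /=; unlock mul; apply/eqP; rewrite equivP.
have := reprK (\pi_quot x); move/eqP; rewrite eqmodE /= => hx.
have := reprK (\pi_quot y); move/eqP; rewrite eqmodE /= => hy.
move: (repr _) (repr _) hx hy => b a hx hy.
have e : (a - x) * y + a * (b - y) = a * b - x * y.
  by rewrite mulrBl mulrBr addrC addrA subrK.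
rewrite -opprB -e; apply: tsidealN; apply: tsidealD; [exact: tsidealMr | exact: tsidealMl].
Qed.
Canonical pi_mul_morph := PiMorph2 pi_mul.

Lemma mulqA : associative mul.
Proof. by move=> x y z; rewrite -[x]reprK -[y]reprK -[z]reprK !piE mulrA. Qed.
Lemma mul1q : left_id one mul.
Proof. by move=> x; rewrite -[x]reprK !piE mul1r. Qed.
Lemma mulq1 : right_id one mul.
Proof. by move=> x; rewrite -[x]reprK !piE mulr1. Qed.
Lemma mulqDl : left_distributive mul +%R.
Proof.
move=> x y z; rewrite -[x]reprK -[y]reprK -[z]reprK.
by rewrite !piE mulrDl.
Qed.
Lemma mulqDr : right_distributive mul +%R.
Proof.
move=> x y z; rewrite -[x]reprK -[y]reprK -[z]reprK.
by rewrite !piE mulrDr.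
Qed.

#[export] HB.instance Definition _ :=
  GRing.Zmodule_isPzRing.Build quot mulqA mul1q mulq1 mulqDl mulqDr.

Definition pi (x : R) : quot := \pi_quot x.

Definition star (s : R -> R) (x : quot) : quot := \pi_quot (s (repr x)).

End Zmod.
Module Exports. HB.reexport. End Exports.
End TSQuot.
Export TSQuot.Exports.

Notation "{ 'tsquot' I }" := (TSQuot.quot I) (format "{ 'tsquot'  I }").

(* Main.v *)
Require Import Defs.
From HB Require Import structures.
From mathcomp Require Import all_boot all_algebra generic_quotient.
From mathcomp Require Import boolp classical_sets.

(* An element j lies in J(S) iff every 1 - r j is left invertible; this
   characterisation passes along R -> R/I in both directions when I <= J(R).
   Two commuting idempotents whose difference lies in J coincide.  Hence in a
   strongly J-*-clean ring every idempotent equals the projection of its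
   decomposition, and once all idempotents are self-adjoint, e + e x (1 - e)
   is an idempotent, which forces e x (1 - e) = 0: the ring is abelian.
   Idempotents lift since, for x - x^2 in I and x = e + u, the images of x
   and e are commuting idempotents of R/I differing by an element of J(R/I).
   Conversely, a projection of R/I lifts to an idempotent f of R, and f^* is
   an idempotent commuting with f with f^* - f in I <= J(R), so f^* = f. *)

Set Implicit Arguments.
Unset Strict Implicit.
Unset Printing Implicit Defensive.

Import GRing.Theory.
Local Open Scope ring_scope.
Local Open Scope classical_set_scope.

Section JacobsonRadical.
Variable S : pzRingType.
Implicit Types (x r e f : S) (L : set S).

Definition left_invertible x := exists v, v * x = 1.

Lemma exists_maximal_left_ideal L : is_left_ideal L -> ~ L 1 ->
  exists2 M, is_maximal_left_ideal M & L `<=` M.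
Proof.
move=> idL L1.
(* Adjoining [L] makes the empty chain harmless. *)
pose P X := is_left_ideal (X `|` L) /\ ~ (X `|` L) 1.
have [A [[idA A1] maxA]] : exists A, P A /\ forall B, A `<` B -> ~ P B.
  apply: Zorn_bigcup => F FP Ftot.
  pose U := \bigcup_(X in F) X.
  have common x y : (U `|` L) x -> (U `|` L) y ->
      exists2 X, P X /\ X `<=` U & (X `|` L) x /\ (X `|` L) y.
    have P0 : P set0 /\ set0 `<=` U by rewrite /P set0U; split=> [|? []].
    have inF X : F X -> P X /\ X `<=` U by move=> FX; split; [exact: FP | exact: bigcup_sup].
    case=> [[X FX Xx]|Lx] [[Y FY Yy]|Ly].
    - have [XY|YX] := Ftot _ _ FX FY.
      + by exists Y; [exact: inF | split; left; [exact: XY|]].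
      + by exists X; [exact: inF | split; left; [|exact: YX]].
    - by exists X; [exact: inF | split; [left|right]].
    - by exists Y; [exact: inF | split; [right|left]].
    - by exists set0; [|split; right].
  have lift X z : X `<=` U -> (X `|` L) z -> (U `|` L) z by move=> XU; apply: setSU.
  split; first split.
  - by right; case: idL.
  - move=> x y hx hy; have [X [[[_ XD _ _] _] XU] [Xx Xy]] := common _ _ hx hy.
    exact: lift XU (XD _ _ Xx Xy).
  - move=> x hx; have [X [[[_ _ XN _] _] XU] [Xx _]] := common _ _ hx hx.
    exact: lift XU (XN _ Xx).
  - move=> r x hx; have [X [[[_ _ _ XM] _] XU] [Xx _]] := common _ _ hx hx.
    exact: lift XU (XM r _ Xx).
  - by move=> h1; have [X [[_ X1] _] [h _]] := common _ _ h1 h1.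
exists (A `|` L); last by move=> x Lx; right.
split=> // N idN N1 AN x Nx; apply: contrapT => nAx.
apply: (maxA N); last by rewrite /P setUidl //; move=> z Lz; apply: AN; right.
split; first by move=> z Az; apply: AN; left.
by move=> NA; apply: nAx; left; exact: NA.
Qed.

Lemma jacobson_left_invertible x : jacobson x -> left_invertible (1 - x).
Proof.
move=> Jx; apply: contrapT => nlinv.
pose L y := exists r, y = r * (1 - x).
have idL : is_left_ideal L.
  split=> [|_ _ [a ->] [b ->]|_ [a ->]|r _ [a ->]].
  - by exists 0; rewrite mul0r.
  - by exists (a + b); rewrite mulrDl.
  - by exists (- a); rewrite mulNr.
  - by exists (r * a); rewrite mulrA.
have L1 : ~ L 1 by case=> v v1; apply: nlinv; exists v.
have [M maxM LM] := exists_maximal_left_ideal idL L1.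
case: (maxM) => [[_ MD _ _] M1 _]; apply: M1.
rewrite -(subrK x 1); apply: MD; last exact: Jx.
by apply: LM; exists 1; rewrite mul1r.
Qed.

Lemma jacobsonMl r x : jacobson x -> jacobson (r * x).
Proof. by move=> Jx M maxM; case: (maxM) => [[_ _ _ MM] _ _]; apply: MM; exact: Jx. Qed.

Lemma jacobsonP x : jacobson x <-> forall r, left_invertible (1 - r * x).
Proof.
split=> [Jx r|linv M maxM]; first exact: jacobson_left_invertible (jacobsonMl r Jx).
case: (maxM) => [[M0 MD MN MM] M1 Mmax]; apply: contrapT => nMx.
pose N y := exists2 m, M m & exists r, y = m + r * x.
have idN : is_left_ideal N.
  split=> [|_ _ [m Mm [r ->]] [n Mn [s ->]]|_ [m Mm [r ->]]|t _ [m Mm [r ->]]].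
  - by exists 0 => //; exists 0; rewrite mul0r addr0.
  - exists (m + n); first exact: MD.
    by exists (r + s); rewrite mulrDl addrACA.
  - by exists (- m); [exact: MN | exists (- r); rewrite mulNr opprD].
  - by exists (t * m); [exact: MM | exists (t * r); rewrite mulrDr mulrA].
have MN' : forall y, M y -> N y by move=> y My; exists y => //; exists 0; rewrite mul0r addr0.
have N1 : ~ N 1.
  case=> m Mm [r /eqP]; rewrite -subr_eq => /eqP m_eq.
  have [v vm] := linv r; apply: M1; rewrite -vm m_eq; exact: MM.
by apply/nMx/(Mmax N idN N1 MN'); exists 0 => //; exists 1; rewrite mul1r add0r.
Qed.

Lemma jacobson_idempotent_eq0 e : e * e = e -> jacobson e -> e = 0.
Proof.
move=> ee /jacobson_left_invertible [v ve].
by rewrite -[e]mul1r -ve -mulrA mulrBl mul1r ee subrr mulr0.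
Qed.

Lemma commuting_idempotents_eq e f : e * e = e -> f * f = f -> e * f = f * e ->
  jacobson (e - f) -> e = f.
Proof.
move=> ee ff ef Jef.
(* For commuting idempotents [e (1 - f)] is an idempotent of [J], hence [0]. *)
have idem_mul1B (g h : S) : g * g = g -> h * h = h -> g * h = h * g ->
    g * (1 - h) * (g * (1 - h)) = g * (1 - h).
  move=> gg hh gh.
  have kk : (1 - h) * (1 - h) = 1 - h by rewrite mulrBr mulr1 !mulrBl mul1r hh subrr subr0.
  have gk : g * (1 - h) = (1 - h) * g by rewrite mulrBr mulrBl mulr1 mul1r gh.
  by rewrite -mulrA (mulrA (1 - h)) -gk !mulrA gg -mulrA kk.
have e1f : e * (1 - f) = 0.
  apply: (jacobson_idempotent_eq0 (idem_mul1B _ _ ee ff ef)).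
  by have := jacobsonMl e Jef; rewrite mulrBr ee -{1}[e]mulr1 -mulrBr.
have f1e : f * (1 - e) = 0.
  apply: (jacobson_idempotent_eq0 (idem_mul1B _ _ ff ee (esym ef))).
  by have := jacobsonMl (- f) Jef; rewrite mulNr mulrBr ff opprB -{1}[f]mulr1 -mulrBr.
move/eqP: e1f; rewrite mulrBr mulr1 subr_eq0 => /eqP e_ef.
move/eqP: f1e; rewrite mulrBr mulr1 subr_eq0 => /eqP f_fe.
by rewrite e_ef ef -f_fe.
Qed.

End JacobsonRadical.

Section Involution.
Variables (S : pzRingType) (star : S -> S).
Hypothesis star_inv : is_involution star.
Implicit Types (x y e : S).

Lemma starB x y : star (x - y) = star x - star y.
Proof. by case: star_inv => starD _ _; apply: (addIr (star y)); rewrite -starD !subrK. Qed.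

Lemma star1 : star 1 = 1.
Proof.
case: star_inv => _ starM starK.
by rewrite -[star 1]mulr1 -{2}(starK 1) -starM mulr1 starK.
Qed.

Lemma idempotent_self_adjoint_of_strongly_J_star_clean e :
  strongly_J_star_clean star -> e * e = e -> star e = e.
Proof.
move=> clean ee; have [f [u [[ff sf] Ju e_fu ef]]] := clean e.
have Jef : jacobson (e - f) by rewrite e_fu addrC addKr.
by rewrite (commuting_idempotents_eq ee ff ef Jef).
Qed.

Section SelfAdjointIdempotents.
Hypothesis idem_self_adjoint : forall e, e * e = e -> star e = e.

Lemma corner_self_adjoint e y : e * e = e -> e * y = y -> y * e = 0 -> star y = y.
Proof.
case: star_inv => starD _ _ ee ey ye.
have yy : y * y = 0 by rewrite -{2}ey mulrA ye mul0r.
have ey_idem : (e + y) * (e + y) = e + y.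
  by rewrite mulrDl !mulrDr ee ey ye yy !addr0.
by move: (idem_self_adjoint ey_idem); rewrite starD (idem_self_adjoint ee) => /addrI.
Qed.

Lemma idempotent_corner_eq0 e x : e * e = e -> e * x * (1 - e) = 0.
Proof.
case: star_inv => _ starM _ ee.
have e1e : e * (1 - e) = 0 by rewrite mulrBr mulr1 ee subrr.
have ee1 : (1 - e) * e = 0 by rewrite mulrBl mul1r ee subrr.
have ey : e * (e * x * (1 - e)) = e * x * (1 - e) by rewrite !mulrA ee.
have ye : e * x * (1 - e) * e = 0 by rewrite -mulrA ee1 mulr0.
rewrite -ey -(corner_self_adjoint ee ey ye) !starM starB star1.
by rewrite (idem_self_adjoint ee) !mulrA e1e !mul0r.
Qed.

Lemma abelian_of_idempotents_self_adjoint : abelian_ring S.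
Proof.
move=> e ee x.
have ee' : (1 - e) * (1 - e) = 1 - e by rewrite mulrBr mulr1 !mulrBl mul1r ee subrr subr0.
move/eqP: (idempotent_corner_eq0 x ee); rewrite mulrBr mulr1 subr_eq0 => /eqP ->.
move/eqP: (idempotent_corner_eq0 x ee'); rewrite subKr !mulrBl mul1r subr_eq0.
by move=> /eqP <-.
Qed.

End SelfAdjointIdempotents.

Lemma abelian_of_strongly_J_star_clean :
  strongly_J_star_clean star -> abelian_ring S.
Proof.
move=> clean; apply: abelian_of_idempotents_self_adjoint => e.
exact: idempotent_self_adjoint_of_strongly_J_star_clean.
Qed.

End Involution.

Section Quotient.
Variables (R : pzRingType) (I : tsideal R).
Local Notation pi := (TSQuot.pi I).

Lemma pi_is_zmod_morphism : {morph pi : x y / x - y}.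
Proof. by move=> x y; rewrite /TSQuot.pi TSQuot.pi_add TSQuot.pi_opp. Qed.

Lemma pi_is_monoid_morphism : GRing.monoid_morphism pi.
Proof.
split; last exact: TSQuot.pi_mul.
by rewrite /TSQuot.pi [RHS]/GRing.one /= /TSQuot.one -lock.
Qed.

HB.instance Definition _ :=
  GRing.isZmodMorphism.Build R {tsquot I} pi pi_is_zmod_morphism.
HB.instance Definition _ :=
  GRing.isMonoidMorphism.Build R {tsquot I} pi pi_is_monoid_morphism.

Lemma pi_eq x y : pi x = pi y <-> x - y \in idpred I.
Proof. by rewrite -TSQuot.equivP; split=> [h|/eqP //]; apply/eqP. Qed.

Lemma pi_repr (q : {tsquot I}) : pi (repr q) = q.
Proof. exact: reprK. Qed.

Lemma jacobson_pi u : jacobson u -> jacobson (pi u).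
Proof.
move=> /jacobsonP Ju; apply/jacobsonP => q.
have [v vu] := Ju (repr q); exists (pi v).
by rewrite -(pi_repr q) -rmorphM -(rmorph1 pi) -rmorphB -rmorphM vu.
Qed.

Lemma jacobson_of_pi u : (forall i, i \in idpred I -> jacobson i) ->
  jacobson (pi u) -> jacobson u.
Proof.
move=> IJ /jacobsonP Ju; apply/jacobsonP => r.
have [q qu] := Ju (pi r).
have /IJ /jacobson_left_invertible [w wq] : 1 - repr q * (1 - r * u) \in idpred I.
  by apply/pi_eq; rewrite rmorph1 rmorphM /= pi_repr rmorphB rmorph1 rmorphM.
by exists (w * repr q); rewrite subKr mulrA in wq.
Qed.

Lemma star_pi (star : R -> R) : is_involution star ->
  (forall x, x \in idpred I -> star x \in idpred I) ->
  forall x, @TSQuot.star R I star (pi x) = pi (star x).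
Proof.
move=> inv starI x; apply/pi_eq; rewrite -(starB inv); apply: starI.
exact/pi_eq/pi_repr.
Qed.

Lemma idempotents_lift_of_strongly_J_star_clean (star : R -> R) :
  strongly_J_star_clean star -> idempotents_lift I.
Proof.
move=> clean x xx; have [e [u [[ee _] Ju x_eu xe]]] := clean x.
exists e; split=> //; apply/pi_eq.
(* [pi x] and [pi e] are commuting idempotents of [R/I] differing by [pi u]. *)
apply: commuting_idempotents_eq.
- by rewrite -rmorphM; apply/esym/pi_eq.
- by rewrite -rmorphM ee.
- by rewrite -!rmorphM xe.
- by rewrite -rmorphB {1}x_eu addrC addKr; exact: jacobson_pi.
Qed.

Section StarQuotient.
Variable star : R -> R.
Hypotheses (star_inv : is_involution star)
  (starI : forall x, x \in idpred I -> star x \in idpred I).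

Lemma strongly_J_star_clean_quotient :
  strongly_J_star_clean star -> strongly_J_star_clean (@TSQuot.star R I star).
Proof.
move=> clean q; have [e [u [[ee se] Ju q_eu qe]]] := clean (repr q).
exists (pi e), (pi u); split.
- by split; [rewrite -rmorphM ee | rewrite (star_pi star_inv starI) se].
- exact: jacobson_pi.
- by rewrite -rmorphD /= -q_eu pi_repr.
- by rewrite -(pi_repr q) -!rmorphM qe.
Qed.

Lemma strongly_J_star_clean_of_quotient : (forall i, i \in idpred I -> jacobson i) ->
  strongly_J_star_clean (@TSQuot.star R I star) -> abelian_ring R ->
  idempotents_lift I -> strongly_J_star_clean star.
Proof.
move=> IJ cleanQ ab lift a.
have [p [w [[pp sp] Jw a_pw _]]] := cleanQ (pi a).
have [f [ff /pi_eq]] : exists f, f * f = f /\ repr p - f \in idpred I.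
  by apply: lift; apply/pi_eq; rewrite rmorphM /= pi_repr pp.
rewrite pi_repr => p_f.
have sf : star f = f.
  have sff : star f * star f = star f by case: star_inv => _ starM _; rewrite -starM ff.
  apply: (commuting_idempotents_eq sff ff (ab _ sff f)); apply: IJ; apply/pi_eq.
  by rewrite -(star_pi star_inv starI) -p_f sp.
exists f, (a - f); split=> //.
- by apply: (jacobson_of_pi IJ); rewrite rmorphB /= -p_f a_pw addrC addKr.
- by rewrite addrC subrK.
- exact/esym/ab.
Qed.

End StarQuotient.
End Quotient.

Theorem theorem3p7 (R : pzRingType) (star : R -> R) (I : tsideal R) :
  is_involution star ->
  (forall x : R, x \in idpred I -> star x \in idpred I) ->
  (forall x : R, x \in idpred I -> jacobson x) ->
  (strongly_J_star_clean star <->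
   [/\ strongly_J_star_clean (@TSQuot.star R I star),
       abelian_ring R &
       idempotents_lift I]).
Proof.
move=> star_inv starI IJ; split=> [clean|[cleanQ ab lift]].
  split.
  - exact: strongly_J_star_clean_quotient star_inv starI clean.
  - exact: abelian_of_strongly_J_star_clean star_inv clean.
  - exact: idempotents_lift_of_strongly_J_star_clean clean.
exact: strongly_J_star_clean_of_quotient star_inv starI IJ cleanQ ab lift.
Qed.
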